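(* Let $a,m$ be integers with $1<a<m$ and $\gcd(a,m)=1$, let $\Lambda(a,m)=\{(x,y)\in\mathbb{Z}\times\mathbb{Z}\mid ax+y\equiv 0 \pmod m\}$, and let $\widehat{\mathcal{X}_0},\dots,\widehat{\mathcal{X}_N}$ be the s-states of Qin's algorithm on input $(a,m)$, with inner products $\mathcal{I}_0,\dots,\mathcal{I}_N$. (1) If the inner product changes sign, i.e. there is an index $k_0$ with $0\le k_0<N$, $\mathcal{I}_{k_0}<0$ and $\mathcal{I}_{k_0+1}\ge 0$, then at least one of the row vectors $\widehat{v}_1^{(k_0)},\widehat{v}_2^{(k_0)},\widehat{v}_1^{(k_0+1)},\widehat{v}_2^{(k_0+1)}$ of the two s-states $\widehat{\mathcal{X}_{k_0}}$ and $\widehat{\mathcal{X}_{k_0+1}}$ is a shortest non-zero vector of $\Lambda(a,m)$. (2) If the inner product does not change sign, i.e. $\mathcal{I}_k<0$ for all $0\le k\le N$, then the first row $\widehat{v}_1^{(N)}$ of the terminating s-state $\widehat{\mathcal{X}_N}$ is a shortest non-zero vector of $\Lambda(a,m)$.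
   Context: Lengths are Euclidean: $\|(x,y)\|^2=x^2+y^2$. A shortest non-zero vector of $\Lambda(a,m)$ is a non-zero element of $\Lambda(a,m)$ of minimal length. Qin's algorithm on input $(a,m)$ produces states $\mathcal{X}_k=\begin{pmatrix} x_{11}^{(k)} & x_{12}^{(k)}\\ x_{21}^{(k)} & x_{22}^{(k)}\end{pmatrix}$, starting from $\mathcal{X}_0=\begin{pmatrix}1&a\\0&m\end{pmatrix}$. For $k\ge 1$: - if $k$ is odd, $q_k=\left\lfloor \frac{x_{22}^{(k-1)}-1}{x_{12}^{(k-1)}}\right\rfloor$, $x_{21}^{(k)}=x_{21}^{(k-1)}+q_kx_{11}^{(k-1)}$, $x_{22}^{(k)}=x_{22}^{(k-1)}-q_kx_{12}^{(k-1)}$, and the first row is unchanged; - if $k$ is even, $q_k=\left\lfloor \frac{x_{12}^{(k-1)}-1}{x_{22}^{(k-1)}}\right\rfloor$, $x_{11}^{(k)}=x_{11}^{(k-1)}+q_kx_{21}^{(k-1)}$, $x_{12}^{(k)}=x_{12}^{(k-1)}-q_kx_{22}^{(k-1)}$, and the second row is unchanged. The algorithm terminates as soon as the upper right entry $x_{12}^{(k)}$ equals $1$; $N$ denotes the index of this terminating state. The s-state is $\widehat{\mathcal{X}_k}=\begin{pmatrix} x_{11}^{(k)} & -x_{12}^{(k)}\\ x_{21}^{(k)} & x_{22}^{(k)}\end{pmatrix}$, with row vectors $\widehat{v}_1^{(k)}=(x_{11}^{(k)},-x_{12}^{(k)})$ and $\widehat{v}_2^{(k)}=(x_{21}^{(k)},x_{22}^{(k)})$.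 The inner product is $\mathcal{I}_k=\langle\widehat{v}_1^{(k)},\widehat{v}_2^{(k)}\rangle=x_{11}^{(k)}x_{21}^{(k)}-x_{12}^{(k)}x_{22}^{(k)}$, for $0\le k\le N$. One has $\mathcal{I}_0=-am<0$. *)

(* Defs.v *)
From Stdlib Require Import ZArith Znumtheory Reals Lia.
Open Scope Z_scope.

Definition norm (v : Z * Z) : R := sqrt (IZR (fst v ^ 2 + snd v ^ 2)).

Definition inner (v w : Z * Z) : Z := fst v * fst w + snd v * snd w.

Definition in_lattice (a m : Z) (v : Z * Z) : Prop := (m | a * fst v + snd v).

Definition shortest_nonzero (a m : Z) (v : Z * Z) : Prop :=
  in_lattice a m v /\ v <> (0, 0) /\
  forall w : Z * Z, in_lattice a m w -> w <> (0, 0) -> (norm v <= norm w)%R.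

Record state : Type := State { x11 : Z; x12 : Z; x21 : Z; x22 : Z }.

(* [Z.div] is floor division. Until the algorithm has terminated, the divisors
   below are positive, so the convention for division by 0 plays no role. *)
Definition odd_step (X : state) : state :=
  let q := (x22 X - 1) / x12 X in
  State (x11 X) (x12 X) (x21 X + q * x11 X) (x22 X - q * x12 X).

Definition even_step (X : state) : state :=
  let q := (x12 X - 1) / x22 X in
  State (x11 X + q * x21 X) (x12 X - q * x22 X) (x21 X) (x22 X).

(* The recursion is total in [k]; only the states up to the terminating index
   belong to the run of the algorithm. *)
Fixpoint qin (a m : Z) (k : nat) : state :=
  match k with
  | O => State 1 a 0 m
  | S k' => (if Nat.odd k then odd_step else even_step) (qin a m k')
  end.

Definition terminates_at (a m : Z) (N : nat) : Prop :=
  x12 (qin a m N) = 1 /\ forall k : nat, (k < N)%nat -> x12 (qin a m k) <> 1.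

Definition row1 (X : state) : Z * Z := (x11 X, - x12 X).
Definition row2 (X : state) : Z * Z := (x21 X, x22 X).

Definition inner_product (a m : Z) (k : nat) : Z :=
  inner (row1 (qin a m k)) (row2 (qin a m k)).

Lemma reduce_bounds (u v : Z) :
  1 < u -> 0 < v -> Z.gcd u v = 1 ->
  0 < v - (v - 1) / u * u < u /\ Z.gcd u (v - (v - 1) / u * u) = 1.
Proof.
intros Hu Hv Hg.
pose proof (Z.div_mod (v - 1) u ltac:(lia)) as Hd.
pose proof (Z.mod_pos_bound (v - 1) u ltac:(lia)) as Hm.
set (q := (v - 1) / u) in *.
assert (Hg' : Z.gcd u (v - q * u) = 1).
{ replace (v - q * u) with (v + (- q) * u) by ring.
  rewrite Z.gcd_add_mult_diag_r; exact Hg. }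
split; [|exact Hg'].
assert (v - q * u <> u).
{ intro E. rewrite E, Z.gcd_diag in Hg'. lia. }
lia.
Qed.

Lemma terminates_from (a m : Z) (b : nat) : forall j : nat,
  let X := qin a m (2 * j) in
  1 <= x12 X < x22 X -> Z.gcd (x12 X) (x22 X) = 1 -> x12 X <= Z.of_nat b ->
  exists n : nat, x12 (qin a m n) = 1.
Proof.
induction b as [|b IH]; intros j X Hb Hg Hle; [lia|].
destruct (Z.eq_dec (x12 X) 1) as [E|E]; [exists (2 * j)%nat; exact E|].
assert (H2 : qin a m (2 * S j) = even_step (odd_step X)).
{ replace (2 * S j)%nat with (S (S (2 * j))) by lia.
  unfold X; cbn [qin].
  replace (Nat.odd (S (S (2 * j)))) with false
    by (symmetry; rewrite !Nat.odd_succ, Nat.even_succ;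
        replace (2 * j)%nat with (0 + 2 * j)%nat by lia;
        rewrite Nat.odd_add_mul_2; reflexivity).
  replace (Nat.odd (S (2 * j))) with true
    by (symmetry; rewrite Nat.odd_succ;
        replace (2 * j)%nat with (0 + 2 * j)%nat by lia;
        rewrite Nat.even_add_mul_2; reflexivity).
  reflexivity. }
destruct (reduce_bounds (x12 X) (x22 X)) as [Hr Hgr]; [lia|lia|exact Hg|].
set (r := x22 X - (x22 X - 1) / x12 X * x12 X) in *.
destruct (Z.eq_dec r 1) as [Er|Er].
- exists (2 * S j)%nat. rewrite H2. unfold even_step, odd_step; cbn [x12 x22].
  fold r. rewrite Er, Z.div_1_r. lia.
- rewrite Z.gcd_comm in Hgr.
  destruct (reduce_bounds r (x12 X)) as [Hs Hgs]; [lia|lia|exact Hgr|].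
  apply (IH (S j)); rewrite H2; unfold even_step, odd_step; cbn [x12 x22];
    fold r; [lia| |lia].
  rewrite Z.gcd_comm; exact Hgs.
Qed.

Lemma terminates (a m : Z) :
  1 < a < m -> Z.gcd a m = 1 -> exists N : nat, terminates_at a m N.
Proof.
intros Ham Hg.
destruct (terminates_from a m (Z.to_nat a) 0) as [n Hn]; cbn; [lia|exact Hg|lia|].
destruct (dec_inh_nat_subset_has_unique_least_element
            (fun k => x12 (qin a m k) = 1)) as [N [[HN Hmin] _]].
- intro k. destruct (Z.eq_dec (x12 (qin a m k)) 1); auto.
- exists n; exact Hn.
- exists N. split; [exact HN|]. intros k Hk E. specialize (Hmin k E). lia.
Qed.

(* Main.v *)
Require Import Defs.
From Stdlib Require Import ZArith Reals.
From Stdlib Require Import Lia.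
Open Scope Z_scope.

(** A step replaces one row [c] of a lattice basis [(b, c)] by [c + q b], and all
    the intermediate vectors [c + t b], [0 <= t <= q], lie in one quadrant.  If
    the inner product with [b] changes sign, it does so between two consecutive
    vectors [c + t b] and [c + (t + 1) b]; together with [b] they form an obtuse
    superbase, so by Selling's formula one of the three is shortest.  For
    [0 < t < q] both coordinates of [c + t b] dominate those of [b] in absolute
    value, so only [b], [c] and [c + q b] remain.  If there is no sign change, one
    more step would produce it, and of the three candidates the terminating first
    row is then the shortest. *)

(** * Shears, lengths and bases of the lattice *)

Definition shear (b : Z * Z) (t : Z) (c : Z * Z) : Z * Z :=
  (fst c + t * fst b, snd c + t * snd b).

(** Two lattice vectors generate the lattice exactly when their determinant is, up to sign, its
    covolume [m]. The absolute value keeps the notion symmetric in the two vectors. *)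
Definition lattice_basis (a m : Z) (b c : Z * Z) : Prop :=
  0 < m /\ in_lattice a m b /\ in_lattice a m c /\
  Z.abs (fst b * snd c - snd b * fst c) = m.

Lemma shear_0 (b c : Z * Z) : shear b 0 c = c.
Proof. destruct b, c; unfold shear; cbn [fst snd]; f_equal; ring. Qed.

Lemma inner_shear_r (b c : Z * Z) (t : Z) :
  inner b (shear b t c) = inner b c + t * inner b b.
Proof. unfold inner, shear; cbn [fst snd]; ring. Qed.

Lemma inner_self_pos (v : Z * Z) : v <> (0, 0) -> 0 < inner v v.
Proof.
destruct v as [x y]; unfold inner; cbn; intro H.
assert (x <> 0 \/ y <> 0) by
  (destruct (Z.eq_dec x 0), (Z.eq_dec y 0); subst; tauto).
nia.
Qed.

Lemma norm_le (v w : Z * Z) : inner v v <= inner w w -> (norm v <= norm w)%R.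
Proof.
intro H; unfold norm; apply sqrt_le_1_alt, IZR_le.
unfold inner in H; rewrite !Z.pow_2_r; exact H.
Qed.

Lemma shortest_nonzero_le (a m : Z) (v w : Z * Z) :
  in_lattice a m w -> w <> (0, 0) -> inner w w <= inner v v ->
  shortest_nonzero a m v -> shortest_nonzero a m w.
Proof.
intros Hw Hw0 Hle (_ & _ & Hmin); split; [exact Hw|split; [exact Hw0|]].
intros z Hz Hz0; apply Rle_trans with (norm v); [apply norm_le; exact Hle|].
apply Hmin; assumption.
Qed.

Section Basis.

Variables (a m : Z) (b c : Z * Z).
Hypothesis Hbc : lattice_basis a m b c.

Lemma lattice_basis_sym : lattice_basis a m c b.
Proof.
destruct Hbc as (Hm & Hb & Hc & Hd); repeat split; auto.
rewrite <- Hd, <- Z.abs_opp; f_equal; ring.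
Qed.

Lemma lattice_basis_shear (t : Z) : lattice_basis a m b (shear b t c).
Proof.
destruct Hbc as (Hm & Hb & Hc & Hd); repeat split; auto.
- unfold in_lattice, shear in *; cbn.
  replace (a * (fst c + t * fst b) + (snd c + t * snd b))
    with ((a * fst c + snd c) + t * (a * fst b + snd b)) by ring.
  apply Z.divide_add_r; [exact Hc|apply Z.divide_mul_r; exact Hb].
- rewrite <- Hd; f_equal; unfold shear; cbn [fst snd]; ring.
Qed.

Lemma lattice_basis_neq0 : b <> (0, 0).
Proof.
destruct Hbc as (Hm & _ & _ & Hd); intro E; rewrite E in Hd; cbn in Hd; lia.
Qed.

(** Cramer's rule: the determinant of any two lattice vectors is a multiple of [m], hence of the
    determinant of the basis, so the coefficients are integers. *)
Lemma lattice_basis_span (w : Z * Z) :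
  in_lattice a m w ->
  exists s t : Z, w = (s * fst b + t * fst c, s * snd b + t * snd c).
Proof.
destruct Hbc as (Hm & Hb & Hc & Hd); intro Hw.
assert (Hcross : forall u v : Z * Z, in_lattice a m u -> in_lattice a m v ->
                 (fst b * snd c - snd b * fst c | fst u * snd v - snd u * fst v)).
{ intros u v Hu Hv; apply Z.divide_abs_l; rewrite Hd.
  replace (fst u * snd v - snd u * fst v)
    with (fst u * (a * fst v + snd v) - fst v * (a * fst u + snd u)) by ring.
  apply Z.divide_sub_r; apply Z.divide_mul_r; assumption. }
destruct (Hcross w c Hw Hc) as [s Hs], (Hcross b w Hb Hw) as [t Ht].
exists s, t; destruct b as [b1 b2], c as [c1 c2], w as [x y]; cbn in *.
assert (b1 * c2 - b2 * c1 <> 0) by lia.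
f_equal; apply (Z.mul_reg_l _ _ (b1 * c2 - b2 * c1)); auto.
- transitivity ((x * c2 - y * c1) * b1 + (b1 * y - b2 * x) * c1); [ring|].
  rewrite Hs, Ht; ring.
- transitivity ((x * c2 - y * c1) * b2 + (b1 * y - b2 * x) * c2); [ring|].
  rewrite Hs, Ht; ring.
Qed.

Lemma shortest_of_basis_bound (v : Z * Z) :
  in_lattice a m v -> v <> (0, 0) ->
  (forall s t : Z, s <> 0 \/ t <> 0 ->
     inner v v <= s * s * inner b b + 2 * (s * t) * inner b c + t * t * inner c c) ->
  shortest_nonzero a m v.
Proof.
intros Hv Hv0 Hmin; split; [exact Hv|split; [exact Hv0|]].
intros w Hw Hw0; apply norm_le.
destruct (lattice_basis_span w Hw) as (s & t & E).
assert (Hst : s <> 0 \/ t <> 0).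
{ destruct (Z.eq_dec s 0) as [Es|]; [|auto].
  destruct (Z.eq_dec t 0) as [Et|]; [|auto].
  subst; exfalso; apply Hw0; f_equal; ring. }
specialize (Hmin s t Hst); subst w; unfold inner in *; cbn; lia.
Qed.

End Basis.

(** * Selling's formula and obtuse superbases *)

(** The right-hand side is Selling's form of the squared length of [s b + t c], and the pairwise
    sums are the squared lengths of [b], [b + c] and [c]. At most one of [s], [t], [s - t] vanishes,
    so at least two of the three squares are at least 1. *)
Lemma selling_bound (p q r s t : Z) :
  0 <= p -> 0 <= q -> 0 <= r -> s <> 0 \/ t <> 0 ->
  Z.min (p + q) (Z.min (p + r) (q + r))
    <= p * ((s - t) * (s - t)) + q * (s * s) + r * (t * t).
Proof.
intros Hp Hq Hr Hst.
assert (Hsq : forall x, x = 0 \/ 1 <= x * x) by (intro x; nia).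
destruct (Hsq s), (Hsq t), (Hsq (s - t)); try lia; nia.
Qed.

(** The superbase is [b], [c], [-(b + c)]; the sign hypotheses make its pairwise inner products
    nonpositive, that is, the Selling parameters nonnegative. *)
Lemma obtuse_superbase_shortest (a m : Z) (b c : Z * Z) :
  lattice_basis a m b c ->
  inner b c <= 0 -> 0 <= inner b (shear b 1 c) -> 0 <= inner c (shear b 1 c) ->
  shortest_nonzero a m b \/ shortest_nonzero a m c \/
  shortest_nonzero a m (shear b 1 c).
Proof.
intros Hbc Hp Hq Hr.
assert (Hb0 := lattice_basis_neq0 _ _ _ _ Hbc).
assert (Hc0 := lattice_basis_neq0 _ _ _ _ (lattice_basis_sym _ _ _ _ Hbc)).
assert (Hs := lattice_basis_shear _ _ _ _ Hbc 1).
assert (Hs0 := lattice_basis_neq0 _ _ _ _ (lattice_basis_sym _ _ _ _ Hs)).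
set (p := - inner b c) in *.
set (q := inner b (shear b 1 c)) in *.
set (r := inner c (shear b 1 c)) in *.
assert (Eb : inner b b = p + q) by (unfold p, q, inner, shear; cbn [fst snd]; ring).
assert (Ec : inner c c = p + r) by (unfold p, r, inner, shear; cbn [fst snd]; ring).
assert (Es : inner (shear b 1 c) (shear b 1 c) = q + r)
  by (unfold q, r, inner, shear; cbn [fst snd]; ring).
assert (Ebc : inner b c = - p) by (unfold p; ring).
assert (Hbound : forall s t, s <> 0 \/ t <> 0 ->
          Z.min (p + q) (Z.min (p + r) (q + r)) <=
          s * s * inner b b + 2 * (s * t) * inner b c + t * t * inner c c).
{ intros s t Hst.
  assert (H := selling_bound p q r s t ltac:(lia) Hq Hr Hst).
  rewrite Eb, Ec, Ebc; lia. }
assert (Hcase : inner b b <= Z.min (p + q) (Z.min (p + r) (q + r)) \/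
                inner c c <= Z.min (p + q) (Z.min (p + r) (q + r)) \/
                inner (shear b 1 c) (shear b 1 c)
                  <= Z.min (p + q) (Z.min (p + r) (q + r))) by lia.
destruct Hcase as [H|[H|H]]; [left|right; left|right; right];
  (apply (shortest_of_basis_bound a m b c Hbc);
   [first [apply Hbc | apply Hs]|assumption|];
   intros s t Hst; specialize (Hbound s t Hst); lia).
Qed.

Lemma sign_change_shortest (a m : Z) (b c : Z * Z) (q : Z) :
  lattice_basis a m b c ->
  inner b c < 0 -> 0 <= inner b (shear b q c) ->
  (forall t, 0 <= t < q -> 0 <= inner (shear b t c) (shear b (t + 1) c)) ->
  (forall t, 0 < t < q -> inner b b <= inner (shear b t c) (shear b t c)) ->
  shortest_nonzero a m b \/ shortest_nonzero a m c \/
  shortest_nonzero a m (shear b q c).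
Proof.
intros Hbc Hneg Hpos Hquad Hdom.
assert (Hb0 := lattice_basis_neq0 _ _ _ _ Hbc).
assert (HB := inner_self_pos b Hb0).
rewrite inner_shear_r in Hpos.
set (B := inner b b) in *; set (C := inner b c) in *.
(* The last index at which [C + t * B] is still negative; the [- 1] makes the inequality strict. *)
set (t := (- C - 1) / B).
assert (Hd := Z.div_mod (- C - 1) B ltac:(lia)).
assert (Hr := Z.mod_pos_bound (- C - 1) B HB).
assert (Ht0 : 0 <= t) by (apply Z.div_pos; lia).
fold t in Hd.
assert (Htq : t < q) by nia.
(* A shortest vector strictly between the two ends can be traded for [b], which is no longer than
   it. *)
assert (Hcand : forall j, 0 <= j <= q -> shortest_nonzero a m (shear b j c) ->
          shortest_nonzero a m b \/ shortest_nonzero a m c \/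
          shortest_nonzero a m (shear b q c)).
{ intros j Hj Hshort.
  destruct (Z.eq_dec j 0) as [->|]; [rewrite shear_0 in Hshort; auto|].
  destruct (Z.eq_dec j q) as [->|]; [auto|].
  left; apply (shortest_nonzero_le a m (shear b j c)); auto.
  - apply Hbc.
  - apply Hdom; lia. }
assert (Hsucc : shear b 1 (shear b t c) = shear b (t + 1) c)
  by (unfold shear; cbn [fst snd]; f_equal; ring).
destruct (obtuse_superbase_shortest a m b (shear b t c)) as [H|[H|H]].
- apply lattice_basis_shear; exact Hbc.
- rewrite inner_shear_r; fold B C; nia.
- rewrite Hsucc, inner_shear_r; fold B C; nia.
- rewrite Hsucc; apply Hquad; lia.
- left; exact H.
- apply (Hcand t); [lia|exact H].
- rewrite Hsucc in H; apply (Hcand (t + 1)); [lia|exact H].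
Qed.

(** * Invariants of the states *)

(** The signs fix the quadrant of each row. Only [x21] may vanish, as it does in the initial
    state. *)
Definition state_inv (a m : Z) (X : state) : Prop :=
  1 <= x11 X /\ 1 <= x12 X /\ 0 <= x21 X /\ 1 <= x22 X /\
  lattice_basis a m (row1 X) (row2 X).

Lemma row2_odd_step (X : state) :
  row2 (odd_step X) = shear (row1 X) ((x22 X - 1) / x12 X) (row2 X).
Proof. unfold row1, row2, shear; cbn; f_equal; ring. Qed.

Lemma row1_even_step (X : state) :
  row1 (even_step X) = shear (row2 X) ((x12 X - 1) / x22 X) (row1 X).
Proof. unfold row1, row2, shear; cbn; f_equal; ring. Qed.

(** Subtracting 1 before dividing leaves a remainder between 1 and [u], positive even when [u]
    divides [v]. *)
Lemma quotient_bounds (u v : Z) :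
  1 <= u -> 1 <= v -> 0 <= (v - 1) / u /\ 1 <= v - (v - 1) / u * u.
Proof.
intros Hu Hv; split; [apply Z.div_pos; lia|].
assert (H := Z.mul_div_le (v - 1) u ltac:(lia)); lia.
Qed.

Lemma odd_step_inv (a m : Z) (X : state) :
  state_inv a m X -> state_inv a m (odd_step X).
Proof.
intros (H11 & H12 & H21 & H22 & Hb).
destruct (quotient_bounds (x12 X) (x22 X) H12 H22) as [Hq Hr].
refine (conj _ (conj _ (conj _ (conj _ _)))); try (cbn; nia).
rewrite row2_odd_step; apply lattice_basis_shear; exact Hb.
Qed.

Lemma even_step_inv (a m : Z) (X : state) :
  state_inv a m X -> state_inv a m (even_step X).
Proof.
intros (H11 & H12 & H21 & H22 & Hb).
destruct (quotient_bounds (x22 X) (x12 X) H22 H12) as [Hq Hr].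
refine (conj _ (conj _ (conj _ (conj _ _)))); try (cbn; nia).
rewrite row1_even_step.
apply lattice_basis_sym, lattice_basis_shear, lattice_basis_sym; exact Hb.
Qed.

Lemma qin_inv (a m : Z) (k : nat) : 1 < a < m -> state_inv a m (qin a m k).
Proof.
intro Ham; induction k as [|k IH].
- repeat split; cbn [qin x11 x12 x21 x22 row1 row2 fst snd]; try lia.
  + exists 0; change (a * 1 + - a = 0 * m); ring.
  + exists 1; change (a * 0 + m = 1 * m); ring.
- cbn [qin]; destruct (Nat.odd (S k)).
  + apply odd_step_inv; exact IH.
  + apply even_step_inv; exact IH.
Qed.

(** The first quotient is at least 1 because [a < m], and [x21] never decreases afterwards. *)
Lemma qin_x21_pos (a m : Z) (k : nat) :
  1 < a < m -> (0 < k)%nat -> 1 <= x21 (qin a m k).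
Proof.
intros Ham Hk; induction k as [|k IH]; [lia|].
destruct k as [|k].
- cbn; assert (1 <= (m - 1) / a) by (apply Z.div_le_lower_bound; lia); lia.
- specialize (IH ltac:(lia)).
  destruct (qin_inv a m (S k) Ham) as (H11 & H12 & H21 & H22 & _).
  set (X := qin a m (S k)) in *.
  assert (E : qin a m (S (S k)) = odd_step X \/ qin a m (S (S k)) = even_step X)
    by (unfold X; cbn [qin]; destruct (Nat.odd (S (S k))); auto).
  clearbody X; destruct E as [->| ->]; cbn; [|exact IH].
  destruct (quotient_bounds (x12 X) (x22 X) H12 H22) as [Hq _]; nia.
Qed.

(** * Sign change within one step, and the terminal state *)

Lemma inner_sym (v w : Z * Z) : inner v w = inner w v.
Proof. unfold inner; ring. Qed.

Lemma odd_step_sign_change (a m : Z) (X : state) :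
  state_inv a m X -> inner (row1 X) (row2 X) < 0 ->
  0 <= inner (row1 (odd_step X)) (row2 (odd_step X)) ->
  shortest_nonzero a m (row1 X) \/ shortest_nonzero a m (row2 X) \/
  shortest_nonzero a m (row2 (odd_step X)).
Proof.
intros (H11 & H12 & H21 & H22 & Hb) Hneg Hpos.
change (row1 (odd_step X)) with (row1 X) in Hpos.
rewrite row2_odd_step in *.
destruct (quotient_bounds (x12 X) (x22 X) H12 H22) as [Hq Hr].
set (q := (x22 X - 1) / x12 X) in *.
apply sign_change_shortest; auto;
  intros t Ht; unfold inner, shear, row1, row2; cbn;
  (* Since [t <= q - 1], the second coordinate is still at least the final remainder plus [x12 X].
     This keeps the next vector in the quadrant and gives the domination over [row1 X]. *)
  assert (Hs1 : t * x12 X <= (q - 1) * x12 X)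
    by (apply Z.mul_le_mono_nonneg_r; lia).
- assert (0 <= t * x11 X) by nia.
  apply Z.add_nonneg_nonneg; apply Z.mul_nonneg_nonneg; lia.
- assert (x11 X <= t * x11 X) by nia.
  apply Z.add_le_mono; [apply Z.mul_le_mono_nonneg; lia|].
  rewrite Z.mul_opp_opp; apply Z.mul_le_mono_nonneg; lia.
Qed.

Lemma even_step_sign_change (a m : Z) (X : state) :
  state_inv a m X -> inner (row1 X) (row2 X) < 0 ->
  0 <= inner (row1 (even_step X)) (row2 (even_step X)) ->
  shortest_nonzero a m (row2 X) \/ shortest_nonzero a m (row1 X) \/
  shortest_nonzero a m (row1 (even_step X)).
Proof.
intros (H11 & H12 & H21 & H22 & Hb) Hneg Hpos.
change (row2 (even_step X)) with (row2 X) in Hpos.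
rewrite row1_even_step in *.
rewrite inner_sym in Hneg, Hpos.
destruct (quotient_bounds (x22 X) (x12 X) H22 H12) as [Hq Hr].
set (q := (x12 X - 1) / x22 X) in *.
apply sign_change_shortest; auto; [apply lattice_basis_sym; exact Hb| |];
  intros t Ht; unfold inner, shear, row1, row2; cbn;
  assert (Hs1 : t * x22 X <= (q - 1) * x22 X)
    by (apply Z.mul_le_mono_nonneg_r; lia).
- assert (0 <= t * x21 X) by nia.
  apply Z.add_nonneg_nonneg; [apply Z.mul_nonneg_nonneg; lia|].
  apply Z.mul_nonpos_nonpos; lia.
- assert (x21 X <= t * x21 X) by nia.
  apply Z.add_le_mono; [apply Z.mul_le_mono_nonneg; lia|].
  (* This second coordinate is negative, so its opposite is compared with [x22 X]. *)
  rewrite <- (Z.mul_opp_opp (- x12 X + t * x22 X)).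
  apply Z.mul_le_mono_nonneg; lia.
Qed.

(** A further odd step, taken whatever the parity of the index, has quotient [x22 X - 1] and forces
    a sign change. Neither other candidate is shorter than [row1 X]: negativity of the inner product
    gives [x22 X > x11 X], and the new second row has second coordinate 1 and first coordinate at
    least [x11 X]. *)
Lemma terminal_row1_shortest (a m : Z) (X : state) :
  state_inv a m X -> 1 <= x21 X -> x12 X = 1 ->
  inner (row1 X) (row2 X) < 0 -> shortest_nonzero a m (row1 X).
Proof.
intros Hinv H21 H12 Hneg.
pose proof Hinv as (H11 & _ & _ & H22 & Hb).
assert (Hlt : x11 X * x21 X < x22 X)
  by (unfold inner, row1, row2 in Hneg; cbn in Hneg; rewrite H12 in Hneg; lia).
assert (H22' : x11 X + 1 <= x22 X) by nia.
assert (Hstep : row2 (odd_step X) = (x21 X + (x22 X - 1) * x11 X, 1))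
  by (unfold row2; cbn; rewrite H12, Z.div_1_r; f_equal; ring).
assert (Hrow1 : row1 X = (x11 X, -1)) by (unfold row1; rewrite H12; reflexivity).
assert (Hlong : x11 X <= x21 X + (x22 X - 1) * x11 X) by nia.
assert (Hmin : forall v, inner (row1 X) (row1 X) <= inner v v ->
          shortest_nonzero a m v -> shortest_nonzero a m (row1 X)).
{ intros v Hv; apply shortest_nonzero_le; [apply Hb| |exact Hv].
  apply (lattice_basis_neq0 a m _ (row2 X)); exact Hb. }
destruct (odd_step_sign_change a m X Hinv Hneg) as [H|[H|H]].
- change (row1 (odd_step X)) with (row1 X).
  rewrite Hstep, Hrow1; unfold inner; cbn [fst snd]; nia.
- exact H.
- apply (Hmin (row2 X)); [|exact H].
  rewrite Hrow1; unfold inner, row2; cbn [fst snd]; nia.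
- apply (Hmin (row2 (odd_step X))); [|exact H].
  rewrite Hrow1, Hstep; unfold inner; cbn [fst snd]; nia.
Qed.

Theorem theorem1p1 :
  forall (a m : Z) (N : nat),
    1 < a < m -> Z.gcd a m = 1 -> terminates_at a m N ->
    (forall k0 : nat, (k0 < N)%nat ->
       inner_product a m k0 < 0 -> 0 <= inner_product a m (S k0) ->
       shortest_nonzero a m (row1 (qin a m k0)) \/
       shortest_nonzero a m (row2 (qin a m k0)) \/
       shortest_nonzero a m (row1 (qin a m (S k0))) \/
       shortest_nonzero a m (row2 (qin a m (S k0)))) /\
    ((forall k : nat, (k <= N)%nat -> inner_product a m k < 0) ->
       shortest_nonzero a m (row1 (qin a m N))).
Proof.
intros a m N Ham _ [HN _]; split.
- intros k _; unfold inner_product; cbn [qin]; intros Hneg Hpos.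
  assert (Hinv := qin_inv a m k Ham).
  (* A step changes one row only, so its three candidates are among the four rows of the two
     states. *)
  destruct (Nat.odd (S k)).
  + destruct (odd_step_sign_change a m _ Hinv Hneg Hpos) as [H|[H|H]]; auto.
  + destruct (even_step_sign_change a m _ Hinv Hneg Hpos) as [H|[H|H]]; auto.
- intro Hneg; apply terminal_row1_shortest.
  + apply qin_inv; exact Ham.
  + apply qin_x21_pos; [exact Ham|].
    (* Termination at index 0 would mean [a = 1]. *)
    destruct N; [cbn in HN; lia|lia].
  + exact HN.
  + apply Hneg; lia.
Qed.
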